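(* Let $\{x^k\}$ be a sequence generated by the algorithm PS-DCA. Suppose that the parameter sequence $\{\lambda_k\}$ has positive upper and lower bounds (there are constants $0<\underline\lambda\le\overline\lambda<\infty$ with $\underline\lambda\le\lambda_k\le\overline\lambda$ for all $k$) and that $\{\rho_k\}$ has a positive lower bound. Then: (1) Any accumulation point of $\{x^k\}$ is a critical point of the problem $\min_{x\in\Omega}E(x)$. (2) Either the sequence $\{x^k\}$ converges, or the set of accumulation points of $\{x^k\}$ forms a continuum on $\mathcal S\cap\Omega$, i.e., the set of accumulation points has the cardinality of the continuum and contains no isolated accumulation points.
   Context: Standing assumptions: $T,B:\mathbb R^n\to\mathbb R$ are (finite-valued) convex functions with $T(\alpha x)=\alpha T(x)\ge 0$ and $B(\alpha x)=\alpha B(x)\ge 0$ for all $\alpha\ge 0$, $x\in\mathbb R^n$; moreover $\{x\in\mathbb R^n: B(x)=0\}\cap\{x\in\mathbb R^n: T(x)=0\}=\{0\}$ and $\Omega:=\{x\in\mathbb R^n: B(x)\ne 0\}$ is nonempty. For $x\in\Omega$, $E(x):=T(x)/B(x)$. $\|\cdot\|$ is the Euclidean norm, $\mathcal S:=\{x\in\mathbb R^n:\|x\|=1\}$, $\partial$ denotes the convex subdifferential, and $\mathrm{prox}_f(x):=\mathrm{argmin}_{y\in\mathbb R^n}\bigl(f(y)+\tfrac12\|x-y\|^2\bigr)$ for a proper lower semicontinuous convex $f$. A point $x^*\in\mathcal S\cap\Omega$ is a critical point of the problem $\min_{x\in\Omega}E(x)$ (equivalently $\min_{x\in\mathcal S\cap\Omega}E(x)$)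 if $E(x^* )\,\partial B(x^* )\cap\partial T(x^* )\ne\emptyset$. Algorithm PS-DCA. Input: an initial point $x^0\in\mathcal S\cap\Omega$ and an acceptance parameter $\epsilon'>0$. For $k=0,1,2,\dots$: (i) take $\lambda_k>0$ and any $v^k\in\partial B(x^k)$, and set $l^k=\mathrm{prox}_{\lambda_kT}(x^k+\lambda_kE(x^k)v^k)$; (ii) take $\rho_k>0$ and any $w^k\in\partial B(0)$, and set $t^k=\mathrm{prox}_{T/\rho_k}\bigl(\tfrac{E(l^k)}{\rho_k}w^k\bigr)$; (iii) with $\tilde g^k(x)=T(x)+\tfrac{\rho_k}{2}\|x\|^2$ and $\tilde h^k(x)=E(l^k)B(x)+\tfrac{\rho_k}{2}\|x\|^2$, if $(\tilde g^k-\tilde h^k)(t^k)<-\epsilon'$ set $y^k=t^k$; otherwise set $y^k=l^k$; (iv) set $x^{k+1}=y^k/\|y^k\|$. (The iterates are well defined: $l^k\in\Omega$ and $x^{k+1}\in\mathcal S\cap\Omega$ for all $k$.) *)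

(* Defs.v *)
From mathcomp Require Import all_boot all_order all_algebra.
From mathcomp Require Import all_classical all_reals all_analysis.
Import Order.TTheory GRing.Theory Num.Theory.
Import numFieldNormedType.Exports.

Set Implicit Arguments.
Unset Strict Implicit.
Unset Printing Implicit Defensive.

Local Open Scope classical_set_scope.
Local Open Scope ring_scope.

Definition dotv (R : realType) (n : nat) (u v : 'rV[R]_n) : R :=
  \sum_i u 0 i * v 0 i.

(* The library norm `|x| on 'rV[R]_n is the sup norm; it induces the same
   topology as this Euclidean one, so limits and cluster points below are the
   library's. *)
Definition enorm (R : realType) (n : nat) (x : 'rV[R]_n) : R :=
  Num.sqrt (dotv x x).

Definition esphere (R : realType) (n : nat) : set 'rV[R]_n :=
  [set x | enorm x = 1].

Definition subdiff (R : realType) (n : nat) (f : 'rV[R]_n -> R)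
    (x : 'rV[R]_n) : set 'rV[R]_n :=
  [set v | forall y, f x + dotv v (y - x) <= f y].

Definition argmin (R : realType) (n : nat) (f : 'rV[R]_n -> R) :
    set 'rV[R]_n :=
  [set p | forall y, f p <= f y].

(* Set-valued; for f convex and finite-valued the objective is strongly convex
   and continuous, so this set is a singleton and [prox f x p] means that p
   is the proximal point. *)
Definition prox (R : realType) (n : nat) (f : 'rV[R]_n -> R)
    (x : 'rV[R]_n) : set 'rV[R]_n :=
  argmin (fun y => f y + 2^-1 * enorm (x - y) ^+ 2).

Definition pos_homogeneous_ge0 (R : realType) (n : nat) (f : 'rV[R]_n -> R) :
    Prop :=
  forall (a : R) (x : 'rV[R]_n), 0 <= a ->
    f (a *: x) = a * f x /\ 0 <= a * f x.

Definition Omega (R : realType) (n : nat) (B : 'rV[R]_n -> R) :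
    set 'rV[R]_n :=
  [set x | B x != 0].

Definition standing_assumptions (R : realType) (n : nat)
    (T B : 'rV[R]_n -> R) : Prop :=
  [/\ convex_function [set: 'rV[R]_n] T /\ convex_function [set: 'rV[R]_n] B,
      pos_homogeneous_ge0 T,
      pos_homogeneous_ge0 B,
      [set x | B x = 0] `&` [set x | T x = 0] = [set 0] &
      Omega B !=set0].

(* Only meaningful on [Omega B]; elsewhere the library's convention 0^-1 = 0
   makes it 0. *)
Definition quotientE (R : realType) (n : nat) (T B : 'rV[R]_n -> R)
    (x : 'rV[R]_n) : R :=
  T x / B x.

Definition critical_point (R : realType) (n : nat) (T B : 'rV[R]_n -> R)
    (x : 'rV[R]_n) : Prop :=
  (@esphere R n `&` Omega B) x /\
  [set quotientE T B x *: v | v in subdiff B x] `&` subdiff T x !=set0.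

(* One iteration, from x to x'; lam, rho are the current parameters and
   eps is the acceptance parameter. *)
Definition PSDCA_step (R : realType) (n : nat) (T B : 'rV[R]_n -> R)
    (eps lam rho : R) (x x' : 'rV[R]_n) : Prop :=
  exists v l w t : 'rV[R]_n,
    [/\ subdiff B x v,
        prox (fun z => lam * T z) (x + (lam * quotientE T B x) *: v) l,
        subdiff B 0 w,
        prox (fun z => T z / rho) ((quotientE T B l / rho) *: w) t &
        let g z := T z + rho / 2 * enorm z ^+ 2 in
        let h z := quotientE T B l * B z + rho / 2 * enorm z ^+ 2 in
        let y := if g t - h t < - eps then t else l in
        x' = (enorm y)^-1 *: y].

Definition PSDCA (R : realType) (n : nat) (T B : 'rV[R]_n -> R)
    (eps : R) (lam rho : nat -> R) (x : nat -> 'rV[R]_n) : Prop :=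
  [/\ 0 < eps,
      (@esphere R n `&` Omega B) (x 0%N) &
      forall k, [/\ 0 < lam k, 0 < rho k &
        PSDCA_step T B eps (lam k) (rho k) (x k) (x k.+1)]].

Definition accumulation_points (R : realType) (n : nat)
    (x : nat -> 'rV[R]_n) : set 'rV[R]_n :=
  cluster (x @ \oo).

Definition forms_continuum_on (R : realType) (n : nat)
    (A D : set 'rV[R]_n) : Prop :=
  [/\ A `<=` D, (A #= [set: R])%card & isolated A = set0].

(* Main.v *)
(* T and B are sublinear, so a subgradient of either at a point is a linear
   minorant that is exact there. The optimality condition of the first proximal
   step reads u := (x - l) / lam + E(x) v in dT(l); testing u against x and l
   gives <x - l, x> <= 0, hence |l| >= 1, and then
   |x - l|^2 <= lam B(l) (E(x) - E(l)). An accepted t lowers E by at least a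
   fixed amount, because T(t) - E(l) B(t) < - eps and B(t) is bounded. So E(x_k)
   decreases to a limit, t is accepted finitely often, and both x_k - l_k and
   x_{k+1} - x_k tend to 0. Passing to the limit in u_k along a subsequence
   gives criticality. As the steps vanish, the distance from an accumulation
   point p to the others takes all values in ]0, |p' - p|[ for any other
   accumulation point p', which rules out isolated points and embeds R in the
   accumulation set; conversely, R^n embeds in the subsets of nat (cuts at
   rationals) and these embed in R by ternary expansions. *)
Require Import Defs.
From mathcomp Require Import all_boot all_order all_algebra.
From mathcomp Require Import all_classical all_reals all_analysis.
From mathcomp Require Import ring lra.
Import Order.TTheory GRing.Theory Num.Theory.
Import numFieldNormedType.Exports.

Local Open Scope classical_set_scope.
Local Open Scope ring_scope.

(** * Euclidean inner product, and its relation to the sup norm *)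

Section DotProduct.
Set Implicit Arguments.
Unset Strict Implicit.
Context {R : realType} {n : nat}.
Implicit Types (x y z v w : 'rV[R]_n) (a : R).

Lemma dotvC x y : dotv x y = dotv y x.
Proof. by apply: eq_bigr => i _; rewrite mulrC. Qed.

Lemma dotvDl x y z : dotv (x + y) z = dotv x z + dotv y z.
Proof. by rewrite -big_split; apply: eq_bigr => i _; rewrite !mxE mulrDl. Qed.

Lemma dotvZl a x y : dotv (a *: x) y = a * dotv x y.
Proof. by rewrite mulr_sumr; apply: eq_bigr => i _; rewrite !mxE mulrA. Qed.

Lemma dotvNl x y : dotv (- x) y = - dotv x y.
Proof. by rewrite -scaleN1r dotvZl mulN1r. Qed.

Lemma dotvDr x y z : dotv x (y + z) = dotv x y + dotv x z.
Proof. by rewrite dotvC dotvDl !(dotvC x). Qed.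

Lemma dotvZr a x y : dotv x (a *: y) = a * dotv x y.
Proof. by rewrite dotvC dotvZl dotvC. Qed.

Lemma dotvNr x y : dotv x (- y) = - dotv x y.
Proof. by rewrite dotvC dotvNl dotvC. Qed.

Definition dotvE := (dotvDl, dotvDr, dotvNl, dotvNr, dotvZl, dotvZr).

Lemma dotv0l x : dotv 0 x = 0.
Proof. by rewrite -(scale0r 0) dotvZl mul0r. Qed.

Lemma dotvv_ge0 x : 0 <= dotv x x.
Proof. by apply: sumr_ge0 => i _; rewrite -expr2 sqr_ge0. Qed.

Lemma enorm_sqr x : enorm x ^+ 2 = dotv x x.
Proof. by rewrite /enorm sqr_sqrtr ?dotvv_ge0. Qed.

Lemma enorm_ge0 x : 0 <= enorm x.
Proof. exact: sqrtr_ge0. Qed.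

Lemma esphereP x : @esphere R n x <-> dotv x x = 1.
Proof.
rewrite -enorm_sqr /esphere /=; split=> [->|]; first by rewrite expr1n.
by move=> /eqP; rewrite sqrp_eq1 ?enorm_ge0// => /eqP.
Qed.

Lemma coord_le_norm x i : `|x 0 i| <= `|x|.
Proof.
rewrite [leRHS]/Num.norm /= mx_normrE; apply/bigmax_geP; right => /=.
by exists (0, i).
Qed.

Lemma norm_le_coord x a : 0 <= a -> (forall i, `|x 0 i| <= a) -> `|x| <= a.
Proof.
move=> a0 xa; rewrite [leLHS]/Num.norm /= mx_normrE.
by apply/bigmax_leP; split=> // -[i j] _ /=; rewrite ord1.
Qed.

Lemma norm_le_enorm x : `|x| <= enorm x.
Proof.
apply: norm_le_coord (enorm_ge0 _) _ => i.
rewrite -sqrtr_sqr /enorm ler_sqrt ?dotvv_ge0// /dotv (bigD1 i)//= -expr2.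
by rewrite lerDl; apply: sumr_ge0 => j _; rewrite -expr2 sqr_ge0.
Qed.

Lemma dotvv_eq0 x : dotv x x = 0 -> x = 0.
Proof.
move=> x0; apply/eqP; rewrite -normr_le0 (le_trans (norm_le_enorm x))//.
by rewrite /enorm x0 sqrtr0.
Qed.

Lemma enorm_gt0 x : x != 0 -> 0 < enorm x.
Proof.
move=> x0; rewrite sqrtr_gt0 lt_neqAle dotvv_ge0 andbT eq_sym.
by apply: contra_neq x0; exact: dotvv_eq0.
Qed.

Lemma esphere_normalize y : y != 0 -> @esphere R n ((enorm y)^-1 *: y).
Proof.
move=> /enorm_gt0 y0; apply/esphereP; rewrite dotvZl dotvZr -enorm_sqr.
by field; rewrite gt_eqF.
Qed.

(** With s = |y| and c = <y, x> / s, the right side minus the left is (s - 1)(s + 1 - 2c). Here s >=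
    1, and c <= 1 because |y / s - x|^2 = 2 - 2c. *)
Lemma dist_normalize_le x y : dotv x x = 1 -> 1 <= dotv y y ->
  dotv ((enorm y)^-1 *: y - x) ((enorm y)^-1 *: y - x)
    <= dotv (y - x) (y - x).
Proof.
move=> x1 y1; have s1 : 1 <= enorm y.
  by rewrite -(@ler_pXn2r _ 2) ?nnegrE ?enorm_ge0// enorm_sqr expr1n.
have := dotvv_ge0 ((enorm y)^-1 *: y - x).
rewrite !dotvE (dotvC x y) x1 -enorm_sqr.
move: (enorm y) s1 (dotv y x) => s s1 p.
have s0 : s != 0 by rewrite gt_eqF//; lra.
have -> : s^-1 * (s^-1 * s ^+ 2) - s^-1 * p - (s^-1 * p - 1) = 2 - 2 * (p / s).
  by field.
have -> : p = (p / s) * s by field.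
rewrite mulfK//; move: (p / s) => c; nra.
Qed.

Lemma cvg_dotv {I : Type} (F : set_system I) {FF : Filter F}
    (f g : I -> 'rV[R]_n) x y :
  f @ F --> x -> g @ F --> y -> dotv (f i) (g i) @[i --> F] --> dotv x y.
Proof.
move=> fx gy; apply: cvg_big => [|j _]; first exact: add_continuous.
apply: cvgM.
  exact: (cvg_comp _ (fun M : 'rV[R]_n => M 0 j) fx (@coord_continuous _ _ _ 0 j x)).
exact: (cvg_comp _ (fun M : 'rV[R]_n => M 0 j) gy (@coord_continuous _ _ _ 0 j y)).
Qed.

(** The topology comes from the sup norm, which the Euclidean norm dominates; this turns Euclidean
    estimates into limits. *)
Lemma cvg0_of_dotvv {I : Type} (F : set_system I) {FF : Filter F}
    (f : I -> 'rV[R]_n) :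
  dotv (f i) (f i) @[i --> F] --> (0 : R) -> f @ F --> (0 : 'rV[R]_n).
Proof.
move=> f0; apply: norm_cvg0.
apply: (@squeeze_cvgr _ _ _ _ (cst 0) (fun i => enorm (f i))).
- by apply: nearW => i; rewrite normr_ge0 norm_le_enorm.
- exact: cvg_cst.
- rewrite -(sqrtr0 R); apply: (cvg_comp _ Num.sqrt f0); exact: sqrt_continuous.
Qed.

End DotProduct.
Arguments dotvE {R n}.

(** * Nonnegative sublinear functions: subgradients, proximal points, continuity *)

Section Sublinear.
Set Implicit Arguments.
Unset Strict Implicit.
Context {R : realType} {n : nat}.
Implicit Types (x y z v w p l : 'rV[R]_n) (f : 'rV[R]_n -> R).

Definition nonneg_sublinear f :=
  [/\ forall a x, 0 <= a -> f (a *: x) = a * f x, forall x, 0 <= f x &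
      forall x y, f (x + y) <= f x + f y].

(** Convexity at the midpoint gives subadditivity once homogeneity clears the factor 1/2. *)
Lemma convex_nonneg_sublinear f : convex_function [set: 'rV[R]_n] f ->
  pos_homogeneous_ge0 f -> nonneg_sublinear f.
Proof.
move=> cf hf; have fZ a x : 0 <= a -> f (a *: x) = a * f x by move=> /hf -/(_ x)[].
split=> // [x|x y]; first by have [_] := hf 1 x ler01; rewrite mul1r.
have h01 : Itv.spec (Itv.num_sem (R := R)) (Itv.Real `[0%Z, 1%Z]) (2^-1 : R).
  by rewrite /Itv.spec /= /Itv.num_sem /= realE invr_ge0 ler0n /= in_itv /=; lra.
have := cf (Itv.Def h01) x y (mem_setT _) (mem_setT _).
rewrite /conv /= -[X in _ *: x + X *: y]/(1 - 2^-1 : R).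
have -> : 1 - 2^-1 = 2^-1 :> R by field.
rewrite -scalerDr fZ; last by rewrite invr_ge0.
change (2^-1 * f (x + y) <= 2^-1 * f x + (1 - 2^-1) * f y -> f (x + y) <= f x + f y).
lra.
Qed.

Lemma nonneg_sublinearZ c f : 0 <= c -> nonneg_sublinear f ->
  nonneg_sublinear (fun z => c * f z).
Proof.
move=> c0 [fZ f0 fD]; split=> [a x a0|x|x y].
- by rewrite fZ// mulrCA.
- by rewrite mulr_ge0.
- by rewrite -mulrDr ler_wpM2l.
Qed.

(** Testing the subgradient inequality at 0 and at 2x gives <v, x> >= f(x) and <v, x> <= f(x). *)
Lemma subdiffP f x v : nonneg_sublinear f ->
  subdiff f x v <-> (forall z, dotv v z <= f z) /\ dotv v x = f x.
Proof.
move=> [fZ f0 fD]; split=> [vx|[vf vx] y]; last first.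
  by rewrite !dotvE vx addrC subrK.
have xE : dotv v x = f x.
  have := vx (0 *: x); have := vx (2 *: x).
  by rewrite !fZ// !dotvE; lra.
by split=> // z; have := vx z; rewrite !dotvE xE; lra.
Qed.

(* Testing the minimality of l along the ray l + s z and letting s -> 0+ gives
   the inequality; along the ray towards 0 it gives the equality. *)
Lemma prox_subdiff f p l : nonneg_sublinear f -> prox f p l ->
  subdiff f l (p - l).
Proof.
move=> sf; have [fZ f0 fD] := sf; move=> pl; apply/subdiffP => //.
have small (a b : R) : (forall s, 0 < s -> s <= 1 -> a <= s * b) -> a <= 0.
  move=> ab; rewrite leNgt; apply/negP => a0.
  have b0 : 0 < b by have := ab 1 ltr01 (lexx _); lra.
  (* This choice gives s b <= a / 2 < a, against a <= s b. *)
  pose s := Num.min 1 (a / (2 * b)).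
  have s0 : 0 < s by rewrite lt_min ltr01 divr_gt0// mulr_gt0.
  have s1 : s <= 1 by rewrite ge_min lexx.
  have sb : s <= a / (2 * b) by rewrite ge_min lexx orbT.
  have := ab s s0 s1; rewrite leNgt => /negP; apply.
  rewrite (@le_lt_trans _ _ (a / (2 * b) * b))//; first by rewrite ler_wpM2r// ltW.
  by rewrite invfM mulrA mulfVK ?gt_eqF//; lra.
have ineq z : dotv (p - l) z <= f z.
  rewrite -subr_le0; apply: (@small _ (2^-1 * dotv z z)) => s s0 s1.
  have := pl (l + s *: z); rewrite !enorm_sqr.
  have := fD l (s *: z); rewrite (fZ _ _ (ltW s0)).
  rewrite !dotvE (dotvC z p) (dotvC z l) (dotvC l p) => h1 h2.
  by rewrite -(ler_pM2l s0); lra.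
split=> //; apply/eqP; rewrite eq_le ineq /=.
rewrite -subr_le0; apply: (@small _ (2^-1 * dotv l l)) => s s0 s1.
have := pl ((1 - s) *: l); rewrite !enorm_sqr fZ ?subr_ge0//.
rewrite !dotvE (dotvC l p) => h.
by rewrite -(ler_pM2l s0); lra.
Qed.

Lemma nonneg_sublinear0 f : nonneg_sublinear f -> f 0 = 0.
Proof. by move=> [fZ _ _]; rewrite -(scale0r 0) fZ// mul0r. Qed.

(** Expand x in the standard basis; each coordinate is at most |x| in absolute value, and the values
    of f at e_i and - e_i cover both signs. *)
Lemma nonneg_sublinear_norm f : nonneg_sublinear f ->
  exists2 L : R, 0 <= L & forall x, f x <= L * `|x|.
Proof.
move=> sf; have [fZ f0 fD] := sf.
pose e i : 'rV[R]_n := delta_mx 0 i.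
exists (\sum_i (f (e i) + f (- e i))).
  by apply: sumr_ge0 => i _; rewrite addr_ge0.
move=> x; rewrite {1}(row_sum_delta x) mulr_suml.
apply: (@le_trans _ _ (\sum_i f (x 0 i *: e i))).
  elim/big_ind2 : _ => [|a b c d ab cd|//]; first by rewrite nonneg_sublinear0.
  by rewrite (le_trans (fD _ _))// lerD.
apply: ler_sum => i _; rewrite mulrDl.
have xi := coord_le_norm x i.
have [x0|x0] := leP 0 (x 0 i).
  rewrite fZ// -[leLHS]addr0 lerD ?mulr_ge0//.
  by rewrite mulrC ler_wpM2l// -(ger0_norm x0).
have nx0 : 0 <= - x 0 i by rewrite oppr_ge0 ltW.
rewrite -[x 0 i]opprK scaleNr -scalerN fZ//.
rewrite -[leLHS]add0r lerD//; first exact: mulr_ge0.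
by rewrite mulrC ler_wpM2l// -(ltr0_norm x0).
Qed.

(** Subadditivity upgrades the linear bound to a Lipschitz bound with the same constant. *)
Lemma nonneg_sublinear_cvg f {I : Type} (F : set_system I) {FF : Filter F}
    (g : I -> 'rV[R]_n) x :
  nonneg_sublinear f -> g @ F --> x -> f (g i) @[i --> F] --> f x.
Proof.
move=> sf gx; have [fZ f0 fD] := sf; have [L L0 fL] := nonneg_sublinear_norm sf.
apply: (@squeeze_cvgr _ _ _ _ (fun i => f x - L * `|x - g i|)
  (fun i => f x + L * `|x - g i|)).
- apply: nearW => i; apply/andP; split.
    have := fD (g i) (x - g i); rewrite addrC subrK.
    by have := fL (x - g i); lra.
  have := fD x (g i - x); rewrite addrC subrK.
  by have := fL (g i - x); rewrite distrC; lra.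
- rewrite -[X in _ --> X]subr0 -(mulr0 L); apply: cvgB; first exact: cvg_cst.
  apply: cvgM; first exact: cvg_cst.
  rewrite -(normr0 'rV[R]_n) -(subrr x); apply: cvg_norm.
  by apply: cvgB => //; exact: cvg_cst.
- rewrite -[X in _ --> X]addr0 -(mulr0 L); apply: cvgD; first exact: cvg_cst.
  apply: cvgM; first exact: cvg_cst.
  rewrite -(normr0 'rV[R]_n) -(subrr x); apply: cvg_norm.
  by apply: cvgB => //; exact: cvg_cst.
Qed.

(* |v|^2 <= <v,v> <= f v <= L |v| *)
Lemma support_bounded f : nonneg_sublinear f ->
  exists2 L : R, 0 <= L & forall v, (forall z, dotv v z <= f z) -> `|v| <= L.
Proof.
move=> /nonneg_sublinear_norm[L L0 fL]; exists L => // v vf.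
have [->|v0] := eqVneq v 0; first by rewrite normr0.
have nv : 0 < `|v| by rewrite normr_gt0.
rewrite -(ler_pM2r nv).
rewrite (le_trans _ (le_trans (vf v) (fL v)))// -enorm_sqr -expr2.
by rewrite ler_pXn2r ?nnegrE ?enorm_ge0 ?norm_le_enorm.
Qed.

End Sublinear.

(** * Descent of the quotient in one iteration *)

Section Descent.
Set Implicit Arguments.
Unset Strict Implicit.
Context {R : realType} {n : nat} (T B : 'rV[R]_n -> R).
Hypotheses (sT : nonneg_sublinear T) (sB : nonneg_sublinear B).
Hypothesis TB0 : forall z, B z = 0 -> T z = 0 -> z = 0.
Implicit Types (x l t v w z : 'rV[R]_n).

Let E := quotientE T B.

Lemma quotientE_ge0 x : 0 <= E x.
Proof. by case: sT sB => _ T0 _ [_ B0 _]; rewrite divr_ge0. Qed.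

Lemma quotientEK x : B x != 0 -> E x * B x = T x.
Proof. by move=> Bx; rewrite /E /quotientE mulfVK. Qed.

Lemma quotientE_scale a x : 0 < a -> E (a *: x) = E x.
Proof.
case: sT sB => TZ _ _ [BZ _ _] a0.
by rewrite /E /quotientE TZ ?BZ ?(ltW a0)// -mulf_div divff ?mul1r ?gt_eqF.
Qed.

(** E is homogeneous of degree 0, so the final normalization of an iteration preserves its value. *)
Lemma normalize_Omega y : Omega B y ->
  (@esphere R n `&` Omega B) ((enorm y)^-1 *: y) /\ E ((enorm y)^-1 *: y) = E y.
Proof.
move=> By; have y0 : y != 0.
  by apply: contra_neq By => ->; exact: nonneg_sublinear0.
have ny : 0 < (enorm y)^-1 by rewrite invr_gt0 enorm_gt0.
split; last exact: quotientE_scale.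
split; first exact: esphere_normalize.
by case: sB => BZ _ _; rewrite /Omega /= (BZ _ _ (ltW ny)) mulf_neq0// gt_eqF.
Qed.

Lemma prox_step_descent lam x v l : 0 < lam -> (@esphere R n `&` Omega B) x ->
  subdiff B x v ->
  prox (fun z => lam * T z) (x + (lam * E x) *: v) l ->
  [/\ subdiff T l (lam^-1 *: (x - l) + E x *: v), Omega B l, 1 <= dotv l l &
      dotv (x - l) (x - l) <= lam * B l * (E x - E l)].
Proof.
move=> lam0 [/esphereP x1 Bx] /(subdiffP _ _ sB)[vB vx].
have lamN0 : lam != 0 by rewrite gt_eqF.
set p := x + _; set u := lam^-1 *: _ + _ => pl.
have pE : p - l = lam *: u.
  by rewrite scalerDr !scalerA mulfV// scale1r addrAC.
have uT : subdiff T l u.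
  have slT := nonneg_sublinearZ (ltW lam0) sT.
  have /(subdiffP _ _ slT) := prox_subdiff slT pl.
  rewrite pE => -[le_u eq_u]; apply/subdiffP => //; split=> [z|].
    by have := le_u z; rewrite dotvZl ler_pM2l.
  by move: eq_u; rewrite dotvZl => /(mulfI lamN0).
have [le_u eq_u] := (subdiffP _ _ sT).1 uT.
(* <u, x> <= T(x) = E(x) B(x) = E(x) <v, x>, and the terms in v cancel. *)
have xl_x : dotv (x - l) x <= 0.
  have := le_u x; rewrite /u (dotvDl (lam^-1 *: _)) !dotvZl vx quotientEK// gerDr.
  by rewrite pmulr_rle0// invr_gt0.
have l1 : 1 <= dotv l l.
  have := dotvv_ge0 (x - l); move: xl_x; rewrite !dotvE (dotvC l x) x1; lra.
(* Expand T(l) = <u, l>, with <v, l> <= B(l) and <x - l, l> = <x - l, x> - |x - l|^2 <= - |x -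
   l|^2. *)
have key : lam * T l + dotv (x - l) (x - l) <= lam * (E x * B l).
  have := ler_wpM2l (quotientE_ge0 x) (vB l); rewrite -(ler_pM2l lam0) => h.
  rewrite -eq_u /u (dotvDl (lam^-1 *: _)) !dotvZl mulrDr mulVKf//.
  by move: xl_x; rewrite !dotvE => xl_x; lra.
have Bl : Omega B l.
  apply/eqP => Bl0; have Tl0 : T l = 0.
    apply/eqP; rewrite eq_le; case: sT => _ -> _; rewrite andbT.
    rewrite -(pmulr_rle0 _ lam0); move: key; rewrite Bl0 !mulr0.
    by have := dotvv_ge0 (x - l); lra.
  by move: l1; rewrite (TB0 Bl0 Tl0) dotv0l; lra.
split=> //; move: key; rewrite -(quotientEK Bl); lra.
Qed.

(** The quadratic terms cancel, so acceptance says T(t) - e B(t) < - eps, which excludes B(t) = 0.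
    The linear minorant of T comes from the optimality of t and later bounds |t|. *)
Lemma accepted_step_descent eps rho e w t : 0 < eps -> 0 < rho -> 0 <= e ->
  (forall z, dotv w z <= B z) ->
  prox (fun z => T z / rho) ((e / rho) *: w) t ->
  T t + rho / 2 * enorm t ^+ 2 - (e * B t + rho / 2 * enorm t ^+ 2) < - eps ->
  [/\ Omega B t, forall z, dotv (e *: w - rho *: t) z <= T z &
      eps <= (e - E t) * B t].
Proof.
move=> eps0 rho0 e0 wB; set p := _ *: w => pt.
have rhoN0 : rho != 0 by rewrite gt_eqF.
have [_ T0 _] := sT; have [_ B0 _] := sB.
rewrite [X in X < _](_ : _ = T t - e * B t); last by lra.
move=> acc; have Bt : Omega B t.
  by apply/eqP => Bt; move: acc (T0 t); rewrite Bt; lra.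
split=> //; last by rewrite mulrBl quotientEK//; lra.
have pE : p - t = rho^-1 *: (e *: w - rho *: t).
  by rewrite scalerBr !scalerA mulVf// scale1r mulrC.
have srT : nonneg_sublinear (fun z => T z / rho).
  rewrite (_ : (fun z => _) = fun z => rho^-1 * T z).
    by apply: nonneg_sublinearZ => //; rewrite invr_ge0 ltW.
  by apply/funext => z; rewrite mulrC.
have /(subdiffP _ _ srT)[+ _] := prox_subdiff srT pt.
by rewrite pE => h z; have := h z; rewrite dotvZl mulrC ler_pM2r ?invr_gt0.
Qed.

(** [C] and [d] are uniform over all x with E(x) <= e0, so they serve every iteration. An accepted t
    may lie far from x, but then E drops by at least [d]; the estimate on x - l holds in both
    cases. *)
Lemma PSDCA_step_descent eps lo hi e0 : 0 < eps -> 0 < lo -> 0 < hi ->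
  0 <= e0 ->
  exists C d : R, 0 < d /\ forall lam rho x x', 0 < lam <= hi -> lo <= rho ->
    (@esphere R n `&` Omega B) x -> E x <= e0 ->
    PSDCA_step T B eps lam rho x x' ->
    [/\ (@esphere R n `&` Omega B) x', E x' <= E x,
      d <= E x - E x' \/ dotv (x' - x) (x' - x) <= C * (E x - E x') &
      exists v l, [/\ subdiff B x v,
        subdiff T l (lam^-1 *: (x - l) + E x *: v) &
        dotv (x - l) (x - l) <= C * (E x - E x')]].
Proof.
move=> eps0 lo0 hi0 e00.
have [LT LT0 boundT] := support_bounded sT.
have [LB LB0 boundB] := support_bounded sB.
have [K K0 leB] := nonneg_sublinear_norm sB.
have [_ B0 _] := sB.
(* [M] bounds |l| through l = x + lam E(x) v - lam u, and [N] bounds an accepted t through rho t =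
   E(l) w - (E(l) w - rho t). *)
pose M := 1 + (hi * (e0 * LB) + hi * LT).
pose N := lo^-1 * (e0 * LB + LT).
have N0 : 0 <= N by rewrite mulr_ge0 ?invr_ge0 ?addr_ge0 ?mulr_ge0// ltW.
(* Adding 1 keeps the divisor in [d] positive even if [K * N] vanishes. *)
have KN0 : 0 < K * N + 1 by rewrite ltr_wpDl// mulr_ge0.
exists (hi * (K * M)), (eps / (K * N + 1)); split; first exact: divr_gt0.
move=> lam rho x x' /andP[lam0 lam_hi] lo_rho Sx Ex_e0.
have rho0 : 0 < rho by exact: lt_le_trans lo_rho.
move=> [v [l [w [t [vx pl /(subdiffP _ _ sB)[wB _] pt /= ->]]]]].
have [ul Bl l1 descent] := prox_step_descent lam0 Sx vx pl.
have Bl0 : 0 < B l by rewrite lt_neqAle eq_sym Bl B0.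
have El_Ex : E l <= E x.
  rewrite -subr_ge0 -(pmulr_rge0 _ (mulr_gt0 lam0 Bl0)).
  exact: le_trans (dotvv_ge0 _) descent.
have [vB _] := (subdiffP _ _ sB).1 vx.
have [uT _] := (subdiffP _ _ sT).1 ul.
set u := _ *: _ + _ in ul uT.
have Ex0 := quotientE_ge0 x.
have lM : `|l| <= M.
  have -> : l = x + (lam *: (E x *: v) - lam *: u).
    rewrite scalerDr !scalerA mulfV ?gt_eqF// scale1r.
    by rewrite opprD [_ *: v + _]addrCA subrr addr0 opprB addrC subrK.
  rewrite (le_trans (ler_normD _ _))// lerD//.
    by case: Sx => <- _; exact: norm_le_enorm.
  rewrite (le_trans (ler_normB _ _))// !(normrZ lam) (normrZ (E x)).
  rewrite (gtr0_norm lam0) (ger0_norm Ex0).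
  have lam_ge0 := ltW lam0.
  apply: lerD; apply: ler_pM => //; [exact: mulr_ge0| |exact: boundT].
  by apply: ler_pM => //; exact: boundB.
have BlM : lam * B l <= hi * (K * M).
  rewrite ler_pM// ?(ltW lam0)//.
  by rewrite (le_trans (leB l))// ler_wpM2l.
have near_l : dotv (x - l) (x - l) <= hi * (K * M) * (E x - E l).
  by rewrite (le_trans descent)// ler_wpM2r// subr_ge0.
have C0 : 0 <= hi * (K * M).
  by rewrite (le_trans _ BlM)// mulr_ge0 ?(ltW lam0)// ltW.
case: ifPn => [acc|_].
  have [Bt qT Et] := accepted_step_descent eps0 rho0 (quotientE_ge0 l) wB pt acc.
  have Bt0 : 0 < B t by rewrite lt_neqAle eq_sym Bt B0.
  have Et_El : E t <= E l.
    by rewrite -subr_ge0 -(pmulr_lge0 _ Bt0); exact: le_trans (ltW eps0) Et.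
  have [St ->] := normalize_Omega Bt.
  split=> //; first exact: le_trans El_Ex.
    left; rewrite ler_pdivrMr//.
    have tN : `|t| <= N.
      have -> : t = rho^-1 *: (E l *: w - (E l *: w - rho *: t)).
        by rewrite opprB addrC subrK scalerA mulVf ?gt_eqF// scale1r.
      rewrite normrZ gtr0_norm ?invr_gt0// ler_pM ?invr_ge0 ?(ltW rho0)//.
        by rewrite lef_pV2.
      rewrite (le_trans (ler_normB _ _))// lerD ?boundT//.
      rewrite normrZ ger0_norm ?quotientE_ge0// ler_pM ?quotientE_ge0 ?boundB//.
      exact: le_trans Ex_e0.
    have BtN : B t <= K * N + 1.
      rewrite (le_trans (leB t))// ler_wpDr// ler_wpM2l//.
    rewrite (le_trans Et)// ler_pM ?(ltW Bt0) ?subr_ge0//.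
    by rewrite lerB.
  (* Since E(t) <= E(l), the bound by E(x) - E(l) weakens to one by E(x) - E(t). *)
  exists v, l; split=> //; rewrite (le_trans near_l)// ler_wpM2l// lerB//.
have [Sl ->] := normalize_Omega Bl.
split=> //; last by exists v, l.
right; case: Sx => /esphereP x1 _.
rewrite (le_trans (dist_normalize_le x1 l1))//.
by rewrite -(opprB x l) dotvNl dotvNr opprK.
Qed.
End Descent.

(** * Row vectors have at most the cardinality of the reals *)

Section Cardinality.
Set Implicit Arguments.
Unset Strict Implicit.
Context {R : realType}.
Implicit Type S : set nat.

(** Truncated Cantor expansion: only the digits 0 and 2 occur, which avoids double
    representations. *)
Definition ternary_sum S n : R := \sum_(i < n) (`[< S i >]%:R * (2 / 3 ^+ i.+1)).

Lemma ternary_sumS S n : ternary_sum S n.+1 =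
  ternary_sum S n + `[< S n >]%:R * (2 / 3 ^+ n.+1).
Proof. by rewrite /ternary_sum big_ord_recr. Qed.

(** The largest tail has all digits 2 and telescopes, as 2 / 3^(k+1) = 3^-k - 3^-(k+1); keeping the
    subtracted term makes the induction close. *)
Lemma ternary_sum_tail S m n :
  ternary_sum S (m + n) <= ternary_sum S m + 3^-1 ^+ m - 3^-1 ^+ (m + n).
Proof.
elim: n => [|n IHn]; first by rewrite addn0 addrK.
rewrite addnS ternary_sumS (le_trans (lerD IHn (lexx _)))//.
rewrite -exprVn exprS; have : 0 <= 3^-1 ^+ (m + n) :> R by rewrite exprn_ge0.
by move: (3^-1 ^+ (m + n)) => q; case: `[< _ >] => /= q0; lra.
Qed.

Lemma ternary_sum_le S m n :
  ternary_sum S n <= ternary_sum S m + 3^-1 ^+ m.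
Proof.
have [mn|/ltnW nm] := leqP m n.
  rewrite -(subnKC mn) (le_trans (ternary_sum_tail _ _ _))//.
  by rewrite gerDl oppr_le0 exprn_ge0.
rewrite ler_wpDr ?exprn_ge0// -(subnKC nm).
elim: (m - n)%N => [|k IHk]; first by rewrite addn0.
by rewrite addnS ternary_sumS ler_wpDr// mulr_ge0// divr_ge0// exprn_ge0.
Qed.

Definition ternary_real S : R := sup (range (ternary_sum S)).

Lemma ternary_real_bounds S m :
  ternary_sum S m <= ternary_real S <= ternary_sum S m + 3^-1 ^+ m.
Proof.
have ub k : ubound (range (ternary_sum S)) (ternary_sum S k + 3^-1 ^+ k).
  by move=> _ [n _ <-]; exact: ternary_sum_le.
have ne : range (ternary_sum S) !=set0 by exists (ternary_sum S m); exists m.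
apply/andP; split; last exact: ge_sup.
by apply: ub_le_sup; [exists (ternary_sum S 0 + 3^-1 ^+ 0); exact: ub|exists m].
Qed.

(** At the first index m where the sets differ, the digit contributes 2 / 3^(m+1), while the
    remaining tail is at most 1 / 3^(m+1). *)
Lemma ternary_real_inj : injective ternary_real.
Proof.
have lt S S' m : (forall i, (i < m)%N -> S i = S' i) -> S m -> ~ S' m ->
    ternary_real S' < ternary_real S.
  move=> eqS Sm S'm.
  have /andP[leS _] := ternary_real_bounds S m.+1.
  have /andP[_ leS'] := ternary_real_bounds S' m.+1.
  rewrite (le_lt_trans leS')// (lt_le_trans _ leS)// !ternary_sumS.
  have -> : ternary_sum S m = ternary_sum S' m.
    by apply: eq_bigr => i _; rewrite eqS.
  rewrite (asboolT Sm) (asboolF S'm) -exprVn.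
  have : 0 < 3^-1 ^+ m.+1 :> R by rewrite exprn_gt0.
  by move: (3^-1 ^+ _) => q q0; rewrite /= mulr0n mulr1n; lra.
move=> S S' eqSS'; apply/funext => k; apply: contrapT => /eqP neq.
have exk : exists k, S k != S' k by exists k.
case: (ex_minnP exk) => m /eqP neqm minm.
have eqS i : (i < m)%N -> S i = S' i.
  move=> im; apply/eqP/negPn/negP => /minm.
  by rewrite leqNgt im.
have [Sm|Sm] := pselect (S m); have [S'm|S'm] := pselect (S' m).
- by apply: neqm; rewrite (propT Sm) (propT S'm).
- by have := lt _ _ _ eqS Sm S'm; rewrite eqSS' ltxx.
- have eqS' i : (i < m)%N -> S' i = S i by move=> /eqS.
  by have := lt _ _ _ eqS' S'm Sm; rewrite eqSS' ltxx.
- by apply: neqm; rewrite (propF Sm) (propF S'm).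
Qed.

Lemma card_rV_le n : ([set: 'rV[R]_n] #<= [set: R])%card.
Proof.
pose cut (x : 'rV[R]_n) : set nat :=
  [set k | exists i (q : rat), k = pickle (i, q) /\ ratr q < x 0 i].
(* Otherwise a rational strictly between the two coordinates lies in the cut of x but not in that of
   y. *)
have cut_sub x y i : cut x `<=` cut y -> x 0 i <= y 0 i.
  move=> xy; rewrite leNgt; apply/negP => /rat_in_itvoo[q].
  rewrite in_itv /= => /andP[yq qx].
  have [|j [q' [/(pcan_inj pickleK)[<- <-] q'y]]] := xy (pickle (i, q)).
    by exists i, q.
  by move: (lt_trans yq q'y); rewrite ltxx.
apply/pcard_injP; exists (ternary_real \o cut) => x y _ _ /ternary_real_inj xy.
by apply/rowP => i; apply/eqP; rewrite eq_le !cut_sub// xy.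
Qed.

End Cardinality.

(** * Accumulation points of sequences with vanishing steps *)

Section AccumulationPoints.
Set Implicit Arguments.
Unset Strict Implicit.
Context {R : realType} {V : normedModType R}.
Implicit Types (x : nat -> V) (K : set V) (a b z : V).

Lemma cluster_seq_near x a (e : R) N : cluster (x @ \oo) a -> 0 < e ->
  exists2 k, (N <= k)%N & `|x k - a| < e.
Proof.
move=> xa e0.
have [|_ [[k Nk <-] ]] := xa (x @` [set k | (N <= k)%N]) (ball a e) _
    (nbhsx_ballx _ _ e0).
  by exists N => // k Nk; exists k.
by rewrite -ball_normE /= distrC => kae; exists k.
Qed.

(* The distance to a moves by vanishing steps between values close to 0 and
   values close to |b - a|, hence comes close to every value in between
   infinitely often. *)
Lemma cluster_dist_intermediate x K a b (c : R) :
  compact K -> (forall k, K (x k)) -> (x k.+1 - x k) @[k --> \oo] --> (0 : V) ->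
  cluster (x @ \oo) a -> cluster (x @ \oo) b -> 0 < c < `|b - a| ->
  exists2 z, cluster (x @ \oo) z & `|z - a| = c.
Proof.
move=> cptK xK dx xa xb /andP[c0 cab].
have visit (e : R) N : 0 < e ->
    exists2 k, (N <= k)%N & `| `|x k - a| - c| < e.
  move=> e0; have [N1 _ N1e] := cvgr0_norm_lt _ dx _ e0.
  have [i Ni ia] := cluster_seq_near (maxn N N1) xa c0.
  have [|j ij jb] := @cluster_seq_near x b (`|b - a| - c) i xb.
    by rewrite subr_gt0.
  have exm : exists m, (i <= m)%N && (c <= `|x m - a|).
    exists j; rewrite ij /=.
    by have := ler_distD (x j) b a; rewrite (distrC b (x j)); lra.
  (* The first index from i on at distance at least c from a. It is not i itself, so its predecessor
     m is still in range and at distance below c; one step, shorter than e, crosses c. *)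
  case: (ex_minnP exm) => -[|m] /andP[im cm] minm.
    by move: im ia; rewrite leqn0 => /eqP ->; lra.
  have le_im : (i <= m)%N.
    by move: im; rewrite leq_eqVlt => /predU1P[iE|//]; move: ia; rewrite iE; lra.
  have mc : `|x m - a| < c.
    by rewrite ltNge; apply/negP => h; have := minm m; rewrite le_im h ltnn => /(_ isT).
  have Nm : (maxn N N1 <= m)%N by exact: leq_trans le_im.
  exists m.+1; first by rewrite (leq_trans _ (leqnSn _))// (leq_trans _ Nm)// leq_maxl.
  have := N1e m (leq_trans (leq_maxr _ _) Nm).
  have := ler_distD (x m) (x m.+1) a.
  by rewrite ger0_norm ?subr_ge0//= ; lra.
have [s s_ge s_near] : exists2 s : nat -> nat, (forall j, (j <= s j)%N) &
    forall j, `| `|x (s j) - a| - c| < j.+1%:R^-1.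
  have /choice[s sP] j : exists k, (j <= k)%N /\ `| `|x k - a| - c| < j.+1%:R^-1.
    by have [|k jk kc] := visit j.+1%:R^-1 j; [rewrite invr_gt0|exists k].
  by exists s => j; have [] := sP j.
have xs_K : (x \o s @ \oo) K by exists 0%N => // k _; exact: xK.
have [z [_ xs_z]] := cptK _ _ xs_K.
exists z.
  apply: cvg_cluster xs_z => P [N _ NP]; exists N => // k Nk.
  exact/NP/(leq_trans Nk).
(* Along a finer filter converging to z, the distance to a tends both to |z - a| and to c. *)
move: xs_z; rewrite cluster_cvgE => -[G PG [Gz xsG]].
have lim1 : `|y - a| @[y --> G] --> `|z - a|.
  by apply: cvg_norm; apply: cvgB => //; exact: cvg_cst.
have lim2 : `|y - a| @[y --> G] --> c.
  apply/cvgrPdistC_lt => e e0; apply: xsG.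
  have [N _ Ne] := cvgr0_norm_lt _ (@cvg_harmonic R) _ e0.
  exists N => // k Nk /=; rewrite (lt_trans (s_near k))//.
  by have := Ne k Nk; rewrite /= ger0_norm.
exact: cvg_unique lim1 lim2.
Qed.

Lemma cvg_subseq {U : topologicalType} (u : nat -> U) (s : nat -> nat)
    (l : set_system U) :
  (forall j, (j <= s j)%N) -> u @ \oo --> l -> u (s j) @[j --> \oo] --> l.
Proof.
move=> s_ge ul P /ul[N _ NP]; exists N => // j Nj.
exact/NP/(leq_trans Nj).
Qed.

Lemma cluster_subseq x a : cluster (x @ \oo) a ->
  exists2 s : nat -> nat, (forall j, (j <= s j)%N) &
    x (s j) @[j --> \oo] --> a.
Proof.
move=> xa.
have /choice[s sP] j : exists k, (j <= k)%N /\ `|x k - a| < j.+1%:R^-1.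
  by have [|k jk kc] := @cluster_seq_near x a j.+1%:R^-1 j xa;
    [rewrite invr_gt0|exists k].
exists s => [j|]; first by have [] := sP j.
apply/cvgrPdistC_lt => e e0.
have [N _ Ne] := cvgr0_norm_lt _ (@cvg_harmonic R) _ e0.
exists N => // k Nk /=; have [_ /lt_trans] := sP k; apply.
by have := Ne k Nk; rewrite /= ger0_norm.
Qed.

End AccumulationPoints.

(** * Criticality of accumulation points *)

Section Limits.
Set Implicit Arguments.
Unset Strict Implicit.
Context {R : realType} {n : nat} (T B : 'rV[R]_n -> R).
Hypotheses (sT : nonneg_sublinear T) (sB : nonneg_sublinear B).
Hypothesis TB0 : forall z, B z = 0 -> T z = 0 -> z = 0.

Let E := quotientE T B.

Lemma compact_norm_le (r : R) : compact [set z : 'rV[R]_n | `|z| <= r].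
Proof.
apply: bounded_closed_compact.
  exists r; split; first exact: num_real.
  by move=> M rM z /= zr; exact: le_trans (ltW rM).
apply: (@closed_comp _ _ (fun z : 'rV[R]_n => `|z|) [set y | y <= r]).
  by move=> z _; exact: norm_continuous.
exact: closed_le.
Qed.

Lemma critical_point_cluster (x v l : nat -> 'rV[R]_n) (lam : nat -> R)
    (lo e0 : R) a :
  0 < lo -> (forall k, lo <= lam k) ->
  (forall k, (@esphere R n `&` Omega B) (x k)) -> (forall k, E (x k) <= e0) ->
  (forall k, subdiff B (x k) (v k)) ->
  (forall k, subdiff T (l k) ((lam k)^-1 *: (x k - l k) + E (x k) *: v k)) ->
  (x k - l k) @[k --> \oo] --> (0 : 'rV[R]_n) ->
  cluster (x @ \oo) a -> critical_point T B a.
Proof.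
move=> lo0 lo_lam xS xe0 xv lu xl xa.
have [LB LB0 boundB] := support_bounded sB.
have vB k := ((subdiffP _ _ sB).1 (xv k)).
have uT k := ((subdiffP _ _ sT).1 (lu k)).
have [s s_ge xs] := cluster_subseq xa.
have [|w [_ ws]] := @compact_norm_le LB _ (fmap_proper_filter (v \o s) eventually_filter).
  by exists 0%N => // k _ /=; apply: boundB => z; have [] := vB (s k).
have [r r_ge vsr] := cluster_subseq ws.
(* Two successive extractions: along s the iterates tend to a, and along r the bounded subgradients
   v tend to w. *)
pose q j := s (r j).
have q_ge j : (j <= q j)%N by exact: leq_trans (r_ge j) (s_ge _).
have xq : x (q j) @[j --> \oo] --> a by exact: (cvg_subseq r_ge xs).
have vq : v (q j) @[j --> \oo] --> w by exact: vsr.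
have xlq : (x (q j) - l (q j)) @[j --> \oo] --> (0 : 'rV[R]_n).
  exact: (cvg_subseq q_ge xl).
have lq : l (q j) @[j --> \oo] --> a.
  rewrite -[a]subr0.
  rewrite (_ : (fun j => _) = (fun j => x (q j) - (x (q j) - l (q j)))).
    exact: cvgB.
  by apply/funext => j; rewrite subKr.
have aS : dotv a a = 1.
  apply: (cvg_unique _ (cvg_dotv xq xq)) => //.
  rewrite (_ : (fun j => _) = cst 1); first exact: cvg_cst.
  by apply/funext => j; have [/esphereP ->] := xS (q j).
have Txq : T (x (q j)) @[j --> \oo] --> T a by exact: nonneg_sublinear_cvg.
have Bxq : B (x (q j)) @[j --> \oo] --> B a by exact: nonneg_sublinear_cvg.
have [_ T0 _] := sT; have [_ B0 _] := sB.
(* If B(a) = 0, then T(x_k) <= e0 B(x_k) forces T(a) = 0 in the limit, hence a = 0, against |a| =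
   1. *)
have aB : Omega B a.
  apply/eqP => Ba; have Ta : T a = 0.
    apply/eqP; rewrite eq_le T0 andbT -(mulr0 e0) -Ba.
    apply: (ler_cvg_to Txq (cvgM (cvg_cst e0) Bxq)).

    apply: nearW => j.
    by have [_ Bx] := xS (q j); rewrite -(quotientEK T Bx) ler_wpM2r.
  by move: aS; rewrite (TB0 Ba Ta) dotv0l; lra.
have Exq : E (x (q j)) @[j --> \oo] --> E a.
  by apply: cvgM => //; exact: cvgV.
have uq : ((lam (q j))^-1 *: (x (q j) - l (q j)) + E (x (q j)) *: v (q j))
    @[j --> \oo] --> E a *: w.
  rewrite -[X in _ --> X]add0r; apply: cvgD; last exact: cvgZ.
  (* The lower bound on lam keeps 1 / lam bounded, so (x - l) / lam vanishes with x - l. *)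
  apply: norm_cvg0; apply: (@squeeze_cvgr _ _ _ _ (cst 0)
      (fun j => lo^-1 * `|x (q j) - l (q j)|)).
  - apply: nearW => j; rewrite normr_ge0 normrZ ler_wpM2r//.
    have lam0 := lt_le_trans lo0 (lo_lam (q j)).
    by rewrite gtr0_norm ?invr_gt0// lef_pV2.
  - exact: cvg_cst.
  - rewrite -(mulr0 lo^-1); apply: cvgM; first exact: cvg_cst.
    by rewrite -(normr0 'rV[R]_n); exact: cvg_norm.
(* The graph of the subdifferential is closed: both conditions of [subdiffP] pass to the limit. *)
have closed_support f (g y : nat -> 'rV[R]_n) g0 y0 : nonneg_sublinear f ->
    (forall j, (forall z, dotv (g j) z <= f z) /\ dotv (g j) (y j) = f (y j)) ->
    g @ \oo --> g0 -> y @ \oo --> y0 -> subdiff f y0 g0.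
  move=> sf gf gg0 yy0; apply/subdiffP => //; split=> [z|].
    apply: (ler_cvg_to (cvg_dotv gg0 (cvg_cst z)) (cvg_cst (f z))).
    by apply: nearW => j; have [] := gf j.
  apply: (cvg_unique _ (cvg_dotv gg0 yy0)) => //.
  rewrite (_ : (fun j => _) = f \o y); first exact: nonneg_sublinear_cvg.
  by apply/funext => j; have [_] := gf j.
split; first by split=> //; exact/esphereP.
exists (E a *: w); split.
  by exists w => //; apply: closed_support vq xq => // j; exact: vB.
by apply: closed_support uq lq => // j; exact: uT.
Qed.

End Limits.

(** * Convergence or a continuum of accumulation points *)

Section ContinuumAlternative.
Set Implicit Arguments.
Unset Strict Implicit.
Context {R : realType} {n : nat}.

Lemma cvg_or_forms_continuum (x : nat -> 'rV[R]_n) (r : R) (D : set 'rV[R]_n) :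
  (forall k, `|x k| <= r) ->
  (x k.+1 - x k) @[k --> \oo] --> (0 : 'rV[R]_n) ->
  accumulation_points x `<=` D ->
  cvg (x @ \oo) \/ forms_continuum_on (accumulation_points x) D.
Proof.
move=> xr dx xD.
have cpt q := @compact_norm_le R n q.
have [|a [_ xa]] := cpt r _ (fmap_proper_filter x eventually_filter).
  by exists 0%N => // k _; exact: xr.
have [one|] := pselect (accumulation_points x `<=` [set a]).
  left; apply/cvg_ex; exists a.
  have ar : `|a| <= r.
    have [s _ xs] := cluster_subseq xa.
    apply: (ler_cvg_to (cvg_norm xs) (cvg_cst r)); exact: nearW.
  (* Radius r + 1 makes this compact ball a neighbourhood of a. *)
  apply: (@compact_cluster_set1 _ a _ [set z : 'rV[R]_n | `|z| <= r + 1]) => //.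
  - have := nbhsx_ballx a 1 ltr01; apply: filterS => z.
    rewrite -ball_normE /= => az.
    by have := ler_distD a z 0; rewrite !subr0 (distrC z); lra.
  - by exists 0%N => // k _ /=; rewrite (le_trans (xr k))// lerDl.
  - by apply/seteqP; split=> // z ->.
move=> /existsNP[b /not_implyP[xb /eqP ba]]; right.
have other p : exists2 p', accumulation_points x p' & p' != p.
  by have [<-|ap] := eqVneq a p; [exists b|exists a].
have sphere p p' (c : R) := @cluster_dist_intermediate R _ x _ p p' c (cpt r) xr dx.
split=> //.
  apply: Cantor_Bernstein.
    exact: card_le_trans (card_leT _) (card_rV_le _).
  have d0 : 0 < `|b - a| by rewrite normr_gt0 subr_eq0.
  (* A logistic curve: it injects the reals into the open interval of attainable distances. *)
  pose c (y : R) := `|b - a| / (1 + expR y).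
  have e1 y : 0 < 1 + expR y by rewrite addr_gt0 ?expR_gt0.
  have /choice[g gP] y : exists z, accumulation_points x z /\ `|z - a| = c y.
    have [|z xz zc] := sphere a b (c y) xa xb; last by exists z.
    rewrite divr_gt0//= ltr_pdivrMr// mulrDr mulr1 ltrDl.
    by rewrite mulr_gt0 ?expR_gt0.
  apply/pcard_leP/injfunPex; exists g => [y _|y y' _ _ gyy'].
    by have [] := gP y.
  have [_ gy] := gP y; have [_ gy'] := gP y'.
  have : c y = c y' by rewrite -gy -gy' gyy'.
  by move/(mulfI (lt0r_neq0 d0))/invr_inj/addrI/expR_inj.
apply/seteqP; split=> // p [/set_mem xp [V /nbhs_ballP[e /= e0 eV] Vp]].
have [p' xp' p'p] := other p.
have d0 : 0 < `|p' - p| by rewrite normr_gt0 subr_eq0.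
(* At distance m / 2 from p there is an accumulation point inside the neighbourhood supposed to
   isolate p. *)
pose m := Num.min e `|p' - p|.
have m0 : 0 < m by rewrite lt_min e0.
have [me mp] : m <= e /\ m <= `|p' - p| by rewrite !ge_min !lexx orbT.
have [|z xz zp] := sphere p p' (m / 2) xp xp'; first by lra.
have : (V `&` accumulation_points x) z.
  by split=> //; apply: eV; rewrite -ball_normE /= distrC zp; lra.
by rewrite Vp /= => zE; move: zp; rewrite zE subrr normr0; lra.
Qed.

End ContinuumAlternative.

(** * Limit behaviour of the iterates *)

Theorem theorem5p3 (R : realType) (n : nat) (T B : 'rV[R]_n -> R)
    (hTB : standing_assumptions T B)
    (eps : R) (lam rho : nat -> R) (x : nat -> 'rV[R]_n)
    (hx : PSDCA T B eps lam rho x)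
    (hlam : exists lo hi : R, 0 < lo /\ forall k, lo <= lam k <= hi)
    (hrho : exists lo : R, 0 < lo /\ forall k, lo <= rho k) :
  (forall a, accumulation_points x a -> critical_point T B a) /\
  (cvg (x @ \oo) \/
   forms_continuum_on (accumulation_points x) (@esphere R n `&` Omega B)).
Proof.
have [[cT cB] hT hB TB0 _] := hTB.
have sT := convex_nonneg_sublinear cT hT.
have sB := convex_nonneg_sublinear cB hB.
have {}TB0 z : B z = 0 -> T z = 0 -> z = 0.
  by move=> Bz Tz; have : [set 0] z by rewrite -TB0.
have [eps0 x0S step] := hx.
have [lo [hi [lo0 lam_lohi]]] := hlam.
have [rlo [rlo0 rho_lo]] := hrho.
have hi0 : 0 < hi.
  by have /andP[] := lam_lohi 0%N; move=> /(lt_le_trans lo0); exact: lt_le_trans.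
pose e k := quotientE T B (x k).
have [C [d [d0 descent]]] := PSDCA_step_descent sT sB TB0 eps0 rlo0 hi0
  (quotientE_ge0 sT sB (x 0%N)).
have lam_hi k : 0 < lam k <= hi.
  by have [-> _ _] := step k; have /andP[] := lam_lohi k.
(* The bound by the initial value is carried along because the descent constants were chosen for
   it. *)
have inv k : (@esphere R n `&` Omega B) (x k) /\ e k <= e 0%N.
  elim: k => // k [Sk ek]; have [_ _ xk] := step k.
  have [Sk1 ek1 _ _] := descent _ _ _ _ (lam_hi k) (rho_lo k) Sk ek xk.
  by split=> //; exact: le_trans ek1 ek.
have stepk k := let: And3 _ _ xk := step k in
  descent _ _ _ _ (lam_hi k) (rho_lo k) (inv k).1 (inv k).2 xk.
have e_cvg : cvgn e.
  apply: nonincreasing_is_cvgn.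
    by apply/nonincreasing_seqP => k; have [] := stepk k.
  by exists 0 => _ [k _ <-]; exact: quotientE_ge0.
have de : (e k - e k.+1) @[k --> \oo] --> (0 : R).
  rewrite -(subrr (limn e)); apply: cvgB => //.
  by move: e_cvg; rewrite -(cvg_shiftS e).
have Cde : (C * (e k - e k.+1)) @[k --> \oo] --> (0 : R).
  by rewrite -(mulr0 C); apply: cvgM => //; exact: cvg_cst.
have vanish (f : nat -> 'rV[R]_n) :
    (\forall k \near \oo, dotv (f k) (f k) <= C * (e k - e k.+1)) ->
    f @ \oo --> (0 : 'rV[R]_n).
  move=> fC; apply: cvg0_of_dotvv.
  apply: (@squeeze_cvgr _ _ _ _ (cst 0) (fun k => C * (e k - e k.+1))) => //.
    by apply: filterS fC => k ->; rewrite dotvv_ge0.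
  exact: cvg_cst.
have dx : (x k.+1 - x k) @[k --> \oo] --> (0 : 'rV[R]_n).
  (* From [N] on, E drops by less than [d], so only the step estimate remains. *)
  apply: vanish; have [N _ Nd] := cvgr0_norm_lt _ de _ d0.
  exists N => // k Nk; have [_ _ [dk|//] _] := stepk k.
  have := Nd k Nk; rewrite /= ltNge => /negP[].
  exact: le_trans dk (ler_norm _).
have /choice[v /choice[l vl]] k : exists v l, [/\ subdiff B (x k) v,
    subdiff T l ((lam k)^-1 *: (x k - l) + e k *: v) &
    dotv (x k - l) (x k - l) <= C * (e k - e k.+1)].
  by have [] := stepk k.
have critical a : accumulation_points x a -> critical_point T B a.
  apply: (@critical_point_cluster _ _ T B sT sB TB0 x v l lam lo (e 0%N)) => //.
  - by move=> k; have /andP[] := lam_lohi k.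
  - by move=> k; have [] := inv k.
  - by move=> k; have [] := inv k.
  - by move=> k; have [] := vl k.
  - by move=> k; have [] := vl k.
  - by apply: vanish; apply: nearW => k; have [] := vl k.
split=> //; apply: (@cvg_or_forms_continuum _ _ x 1) => //.
  by move=> k; have [[<- _] _] := inv k; exact: norm_le_enorm.
by move=> a /critical[].
Qed.
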